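(* Let $\pi^0=\mathbf{1}/k$. For any closed and convex function $f:\mathbb{R}^{k-1}\to\mathbb{R}\cup\{+\infty\}$ such that $f(\mathbf{1})=0$, the convex losses defined by $$L(\alpha,i)=-\alpha_i+\sup_{\pi\in\Delta_k}\Big\{\pi^T\alpha-k\pi_kf\Big(\frac{\pi_1}{\pi_k},\ldots,\frac{\pi_{k-1}}{\pi_k}\Big)\Big\},\qquad i=1,\ldots,k,\ \alpha\in\mathbb{R}^k,$$ satisfy, with $H_L(\pi)=\inf_{\alpha\in\mathbb{R}^k}\sum_{i=1}^k\pi_iL(\alpha,i)$, $$f(t)=\sup_{\alpha\in\mathbb{R}^k}\Big\{H_L(\pi^0)-\sum_{i=1}^{k-1}\pi^0_iL(\alpha,i)t_i-\pi^0_kL(\alpha,k)\Big\}\quad\text{for }t\in\mathbb{R}^{k-1}_+.$$ Additionally, for all probability distributions $P_1,\ldots,P_k$ on a common measurable space $\mathcal{X}$, $$D_f(P_1,\ldots,P_{k-1}\,\|\,P_k)=\inf_{\alpha\in\mathbb{R}^k}\sum_{i=1}^k\pi^0_iL(\alpha,i)-\inf_\gamma\mathbb{E}[L(\gamma(X),Y)],$$ where the infimum is over measurable $\gamma:\mathcal{X}\to\mathbb{R}^k$ and the expectation is over $Y\sim\pi^0$ and $X\sim P_y$ conditional on $Y=y$.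
   Context: $\Delta_k=\{p\in\mathbb{R}^k_+ : \mathbf{1}^Tp=1\}$; a convex function is closed if its epigraph is closed. For $\mu$ dominating all $P_i$, $p_i=dP_i/d\mu$, the $f$-divergence is $$D_f(P_1,\ldots,P_{k-1}\|P_k)=\int f\Big(\frac{p_1(x)}{p_k(x)},\ldots,\frac{p_{k-1}(x)}{p_k(x)}\Big)p_k(x)\,d\mu(x).$$ Expressions $uf(t/u)$ (with $u\ge0$, $t\in\mathbb{R}^{k-1}_+$) are always understood as the closed perspective $\widetilde f(t,u)$, equal to $uf(t/u)$ if $u>0$ and $\lim_{s\downarrow0}sf(t'-t+t/s)$ if $u=0$, for an arbitrary $t'\in\operatorname{relint}\operatorname{dom}f$ (the value does not depend on $t'$). *)

(* Defs.v *)
From HB Require Import structures.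
From mathcomp Require Import all_boot all_order all_algebra.
From mathcomp Require Import all_classical all_reals all_analysis.

Set Implicit Arguments.
Unset Strict Implicit.
Unset Printing Implicit Defensive.

Import Order.TTheory GRing.Theory Num.Theory.
Import numFieldNormedType.Exports.

Local Open Scope classical_set_scope.
Local Open Scope ring_scope.
Local Open Scope ereal_scope.
Local Open Scope charge_scope.

(* The number of classes is k = n.+1: R^k is 'rV[R]_n.+1, R^(k-1) is 'rV[R]_n,
   the indices 1, ..., k are 'I_n.+1 and the last one, k, is ord_max. *)

Section convex_analysis.
Variables (R : realType) (n : nat).
Implicit Types (A : set 'rV[R]_n) (g : 'rV[R]_n -> \bar R).

(* Convexity for functions with values in R U {+oo}.  In \bar R, 0 * +oo = 0,
   so that the inequality is trivial for l = 0 and l = 1. *)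
Definition convex_ereal g :=
  (forall x, g x != -oo) /\
  forall (x y : 'rV[R]_n) (l : R), (0 <= l <= 1)%R ->
    g (l *: x + (1 - l) *: y)%R <= l%:E * g x + (1 - l)%:E * g y.

Definition epigraph g : set ('rV[R]_n * R) := [set z | g z.1 <= z.2%:E].

Definition closed_function g := closed (epigraph g).

Definition dom g : set 'rV[R]_n := [set x | g x < +oo].

Definition affine_set A :=
  forall (x y : 'rV[R]_n) (l : R), A x -> A y -> A (l *: x + (1 - l) *: y)%R.

Definition affine_hull A : set 'rV[R]_n := smallest affine_set A.

Definition relint A : set 'rV[R]_n :=
  [set x | A x /\ \forall y \near x, affine_hull A y -> A y].

(* [get] picks a point of relint (dom g); when g is closed, convex and proper
   the limit does not depend on it.  The perspective is meant for 0 <= u only: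
   its values for u < 0 are irrelevant. *)
Definition closed_perspective g (t : 'rV[R]_n) (u : R) : \bar R :=
  if (0 < u)%R then u%:E * g (u^-1 *: t)%R
  else let t' := get (relint (dom g)) in
       lim (s%:E * g (t' - t + s^-1 *: t)%R @[s --> 0%R^'+]).

End convex_analysis.

Section multiclass.
Variables (R : realType) (n : nat).
Implicit Types (a p : 'rV[R]_n.+1) (f : 'rV[R]_n -> \bar R).

Definition simplex : set 'rV[R]_n.+1 :=
  [set p | (forall i, 0 <= p 0 i)%R /\ (\sum_i p 0 i = 1)%R].

(* The inclusion of {1, ..., k-1} into {1, ..., k}. *)
Definition inner (i : 'I_n) : 'I_n.+1 := widen_ord (leqnSn n) i.

Definition uniform_prior : 'rV[R]_n.+1 := const_mx (n.+1%:R^-1)%R.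

Definition loss f a (i : 'I_n.+1) : \bar R :=
  (- a 0 i)%:E +
  ereal_sup [set (\sum_j p 0 j * a 0 j)%:E
                 - (n.+1%:R)%:E
                   * closed_perspective f (\row_(j < n) p 0 (inner j))%R
                                          (p 0 ord_max)%R
            | p in simplex].

Definition entropy (L : 'rV[R]_n.+1 -> 'I_n.+1 -> \bar R) p : \bar R :=
  ereal_inf [set \sum_i (p 0 i)%:E * L a i | a in [set: 'rV[R]_n.+1]].

Context {d : measure_display} {T : measurableType d}.
Implicit Types (P : 'I_n.+1 -> probability T R).

(* fine only changes the codomain: the derivatives are finite everywhere
   as soon as mu dominates every P i. *)
Definition f_divergence f P (mu : {sigma_finite_measure set T -> \bar R}) :
    \bar R :=
  let density i x := fine (('d (charge_of_finite_measure (P i)) '/d mu) x) in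
  \int[mu]_x closed_perspective f (\row_(i < n) density (inner i) x)
                                  (density ord_max x).

(* The expectation of g (X, Y) when Y ~ p and X ~ P y conditional on Y = y. *)
Definition expectation_XY p P (g : T -> 'I_n.+1 -> \bar R) : \bar R :=
  \sum_y (p 0 y)%:E * \int[P y]_x g x y.

(* Not both the positive and the negative part of g (X, Y) have an infinite
   expectation; otherwise the expectation is undefined, whereas the addition
   of \bar R would yield +oo - oo = -oo. *)
Definition expectation_exists p P (g : T -> 'I_n.+1 -> \bar R) :=
  expectation_XY p P (fun x y => maxe (g x y) 0) < +oo \/
  expectation_XY p P (fun x y => maxe (- g x y) 0) < +oo.

Definition borel_measurable (gamma : T -> 'rV[R]_n.+1) :=
  measurable_fun [set: T]
    (gamma : T -> g_sigma_algebraType (@open 'rV[R]_n.+1)).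

Definition bayes_risk p P (L : 'rV[R]_n.+1 -> 'I_n.+1 -> \bar R) : \bar R :=
  ereal_inf [set expectation_XY p P (fun x y => L (gamma x) y)
            | gamma in [set gamma | borel_measurable gamma /\
                expectation_exists p P (fun x y => L (gamma x) y)]].

End multiclass.

(* Main.v *)
Require Import Defs.
From HB Require Import structures.
From mathcomp Require Import all_boot all_order all_algebra.
From mathcomp Require Import all_classical all_reals all_analysis.
From mathcomp Require Import measurable_realfun.
From mathcomp Require Import ring lra.

Set Implicit Arguments.
Unset Strict Implicit.
Unset Printing Implicit Defensive.

Import Order.TTheory GRing.Theory Num.Theory.
Import numFieldNormedType.Exports.

Local Open Scope classical_set_scope.
Local Open Scope ring_scope.
Local Open Scope ereal_scope.

(** Everything is read off one set attached to [f], the set [M] of vectors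
    [c = (a, b)] such that [<a, t> + b <= f t] for all [t].

    By separation in the epigraph ([fenchel_moreau]), a closed proper convex
    [f] is the supremum of these affine minorants.  Homogenizing, the closed
    perspective at [(t, u)] is the support function of [M],
    [phi (t, u) = sup_(c in M) <c, (t, u)>], including the boundary [u = 0],
    where it becomes the recession function ([closed_perspectiveE]).  So [phi]
    is positively homogeneous, and [f t = phi (t, 1)].

    Write [k] for the number of classes and [G a] for the supremum, over the
    simplex, of [<p, a> - k phi p].  The loss is [L (a, i) = G a - a_i], and
    two facts about [G] carry the theorem.  Fenchel-Young, scaled from the
    simplex to the positive orthant, reads
    [<p, a> - (sum p) G a <= k phi p], that is
    [- sum_i p_i L (a, i) <= k phi p].  Conversely [G (k c) <= 0] for [c] in
    [M], so that the scores [a = k c] approach equality.  At [p = (1, ..., 1)],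
    where [phi] vanishes, this gives a zero entropy for the uniform prior; at
    [p = (t, 1)] it gives the formula for [f t].

    For the divergence, let [q x] be the vector of the densities of the
    [P_i], so that [D_f] is the integral of [phi (q x)].  Integrating
    Fenchel-Young at [p = q x] and [a = gamma x] bounds the risk of every
    [gamma] from below by [- D_f] ([expectation_ge]).  For the other direction
    [M] is replaced by a countable dense family [c_0, c_1, ...]
    ([countable_minorants]).  The predictor that plays [k c_m], with [m <= N]
    maximizing [<c_m, q x>], takes finitely many values, and its risk is at
    most minus the integral of [max_(m <= N) <c_m, q x>] ([plug_in_risk]).
    Monotone convergence as [N] grows turns this maximum into [phi (q x)]. *)

(** * The inner product and projections in R^n *)

Section dot.
Variable R : realType.
Local Open Scope ring_scope.

Definition dot n (x y : 'rV[R]_n) : R := \sum_i x 0 i * y 0 i.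

Lemma dotC n (x y : 'rV[R]_n) : dot x y = dot y x.
Proof. by apply: eq_bigr => i _; rewrite mulrC. Qed.

Lemma dotDl n (x y z : 'rV[R]_n) : dot (x + y) z = dot x z + dot y z.
Proof. by rewrite -big_split; apply: eq_bigr => i _; rewrite mxE mulrDl. Qed.

Lemma dotZl n l (x y : 'rV[R]_n) : dot (l *: x) y = l * dot x y.
Proof. by rewrite mulr_sumr; apply: eq_bigr => i _; rewrite mxE mulrA. Qed.

Lemma dotDr n (x y z : 'rV[R]_n) : dot x (y + z) = dot x y + dot x z.
Proof. by rewrite dotC dotDl !(dotC _ x). Qed.

Lemma dotZr n l (x y : 'rV[R]_n) : dot x (l *: y) = l * dot x y.
Proof. by rewrite dotC dotZl dotC. Qed.

Lemma dotBl n (x y z : 'rV[R]_n) : dot (x - y) z = dot x z - dot y z.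
Proof. by rewrite -scaleN1r dotDl dotZl mulN1r. Qed.

Lemma dotBr n (x y z : 'rV[R]_n) : dot x (y - z) = dot x y - dot x z.
Proof. by rewrite dotC dotBl !(dotC _ x). Qed.

Lemma dot_sqr_ge0 n (x : 'rV[R]_n) : 0 <= dot x x.
Proof. by apply: sumr_ge0 => i _; rewrite -expr2 sqr_ge0. Qed.

Lemma dot_sqr_coord n (x : 'rV[R]_n) i : x 0 i ^+ 2 <= dot x x.
Proof.
rewrite /dot (bigD1 i)//= expr2 lerDl.
by apply: sumr_ge0 => j _; rewrite -expr2 sqr_ge0.
Qed.

Lemma dot_sqr_eq0 n (x : 'rV[R]_n) : dot x x = 0 -> x = 0.
Proof.
move=> x0; apply/rowP => i; rewrite mxE; apply/eqP.
by rewrite -sqrf_eq0 eq_le sqr_ge0 andbT -x0 dot_sqr_coord.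
Qed.

Lemma row_normP n (x : 'rV[R]_n) r : 0 <= r ->
  (`|x| <= r) <-> (forall i, `|x 0 i| <= r).
Proof.
move=> r0; rewrite [`|x|]/Num.norm /= mx_normrE; split.
  by move=> /bigmax_leP[_ H] i; exact: (H (0, i) isT).
by move=> H; apply/bigmax_leP; split => // -[i j] _ /=; rewrite ord1.
Qed.

Lemma dot_le_norm n (x y : 'rV[R]_n) : `|dot x y| <= `|x| * \sum_i `|y 0 i|.
Proof.
rewrite mulr_sumr; apply: le_trans (ler_norm_sum _ _ _) _.
apply: ler_sum => i _; rewrite normrM ler_wpM2r//.
by apply: (row_normP x (normr_ge0 x)).1.
Qed.

Lemma continuous_sum (T : topologicalType) (I : finType) (F : I -> T -> R) :
  (forall i, continuous (F i)) -> continuous (fun x => \sum_i F i x).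
Proof.
move=> Fc; elim: (index_enum I) => [|i r IH] x.
  under eq_fun do rewrite big_nil; exact: cvg_cst.
under eq_fun do rewrite big_cons.
by apply: cvgD; [exact: Fc|exact: IH].
Qed.

Lemma continuous_dot n (x : 'rV[R]_n) : continuous (dot x).
Proof.
apply: continuous_sum => i y.
apply: (@continuousM _ _ (fun=> x 0 i) (fun y : 'rV_n => y 0 i)).
  exact: cst_continuous.
exact: coord_continuous.
Qed.

Lemma continuous_dot_sqr n (z : 'rV[R]_n) :
  continuous (fun x : 'rV[R]_n => dot (x - z) (x - z)).
Proof.
apply: continuous_sum => i y.
have H : (fun x : 'rV[R]_n => (x - z) 0 i) @ y --> (y - z) 0 i.
  under eq_fun do rewrite mxE; rewrite mxE.
  apply: (@continuousD _ _ _ (fun x : 'rV[R]_n => x 0 i) (fun=> (- z) 0 i)).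
    exact: coord_continuous.
  exact: cst_continuous.
exact: (cvgM H H).
Qed.

End dot.

Section projection.
Variable R : realType.
Local Open Scope ring_scope.

Definition convex n (C : set 'rV[R]_n) :=
  forall x y l, 0 <= l <= 1 -> C x -> C y -> C (l *: x + (1 - l) *: y).

(** The Euclidean projection [y] of [z] is a minimizer of [|x - z|^2] over [C];
    moving from [y] towards a point [x] of [C] cannot decrease this distance,
    and the first-order term of its variation is [- 2 <x - y, z - y>]. *)
Lemma closed_convex_projection n (C : set 'rV[R]_n) z :
  closed C -> convex C -> C !=set0 ->
  exists2 y, C y & forall x, C x -> dot (x - y) (z - y) <= 0.
Proof.
move=> Ccl Cco [x0 Cx0]; pose q x := dot (x - z) (x - z).
(* Only the points no farther from z than x0 compete, and they form a
   compact set. *)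
pose K := C `&` [set x | q x <= q x0].
have Kcl : closed K.
  apply: closedI => //; apply: (@preimage_closed _ _ q [set r | r <= q x0]).
    by move=> x _; exact: continuous_dot_sqr.
  exact: closed_le.
have Kbd : bounded_set K.
  exists (`|z| + (1 + q x0)); split; first exact: num_real.
  move=> M /ltW zM x [_ /= qx].
  apply: le_trans zM; have := ler_normD z (x - z); rewrite [z + _]addrC subrK.
  move=> /le_trans; apply; rewrite lerD2l.
  have q0 : 0 <= q x0 by exact: dot_sqr_ge0.
  apply/row_normP => [|i]; first by lra.
  have : `|(x - z) 0 i| ^+ 2 <= q x0.
    by rewrite real_normK ?num_real//; apply: le_trans qx; exact: dot_sqr_coord.
  have := normr_ge0 ((x - z) 0 i); set r := `|_|.
  nra.
have [y] : exists2 c, c \in K & forall t, t \in K -> q c <= q t.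
  apply: EVT_min_rV.
  - by exists x0; split => //=.
  - exact: bounded_closed_compact.
  - by apply: continuous_subspaceT => x; exact: continuous_dot_sqr.
rewrite inE => -[Cy qy] ymin; exists y => // x Cx.
have qmin w : C w -> q y <= q w.
  move=> Cw; case: (leP (q w) (q x0)) => [qw|/ltW]; last exact: le_trans.
  by apply: ymin; rewrite inE; split.
rewrite leNgt; apply/negP => d0.
set d := dot _ _ in d0; set e := dot (x - y) (x - y).
have key l : 0 <= l <= 1 -> 2 * l * d <= l ^+ 2 * e.
  move=> l01; have := qmin _ (Cco x y l l01 Cx Cy).
  have -> : l *: x + (1 - l) *: y = y + l *: (x - y).
    by apply/rowP => i; rewrite !mxE; ring.
  rewrite /q; have -> : y + l *: (x - y) - z = l *: (x - y) - (z - y).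
    by apply/rowP => i; rewrite !mxE; ring.
  have -> : y - z = (-1) *: (z - y) by apply/rowP => i; rewrite !mxE; ring.
  have sqB (v w : 'rV[R]_n) : dot (v - w) (v - w) = dot v v - 2 * dot v w + dot w w.
    by rewrite dotBl !dotBr (dotC w v); ring.
  by rewrite sqB !(dotZl, dotZr) -/d -/e; lra.
have e0 : 0 <= e by exact: dot_sqr_ge0.
(* The variation l^2 e - 2 l d is negative for small l; this l is small
   enough, and at most 1. *)
pose l := d / (d + e).
have de : 0 < d + e by rewrite ltr_wpDr.
have l0 : 0 < l by rewrite divr_gt0.
have l1 : l <= 1 by rewrite ler_pdivrMr// mul1r lerDl.
have := key l; rewrite (ltW l0) l1 => /(_ isT).
have : l * (d + e) = d by rewrite divfK// gt_eqF.
have := mulr_gt0 l0 d0.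
nra.
Qed.

End projection.

(** * Closed convex functions as suprema of affine minorants *)

Section snoc.
Variables (R : realType) (n : nat).
Local Open Scope ring_scope.

(** Points of [R^n.+1] are pairs of a point of [R^n] and a last coordinate;
    [body] and the entry at [ord_max] are the two projections. *)
Definition snoc (a : 'rV[R]_n) (b : R) : 'rV[R]_n.+1 :=
  \row_i oapp (a 0) b (unlift ord_max i).

Definition body (p : 'rV[R]_n.+1) : 'rV[R]_n := \row_(j < n) p 0 (inner j).

Lemma inner_lift (i : 'I_n) : inner i = lift ord_max i.
Proof. by apply/val_inj; rewrite /= /bump leqNgt ltn_ord. Qed.

Lemma snoc_inner a b i : snoc a b 0 (inner i) = a 0 i.
Proof. by rewrite mxE inner_lift liftK. Qed.

Lemma snoc_max a b : snoc a b 0 ord_max = b.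
Proof. by rewrite mxE unlift_none. Qed.

Lemma body_snoc a b : body (snoc a b) = a.
Proof. by apply/rowP => i; rewrite mxE snoc_inner. Qed.

Lemma snoc_body p : snoc (body p) (p 0 ord_max) = p.
Proof.
apply/rowP => i; rewrite mxE; case: unliftP => [j ->|->] //=.
by rewrite mxE inner_lift.
Qed.

Lemma dot_recr (p q : 'rV[R]_n.+1) :
  dot p q = dot (body p) (body q) + p 0 ord_max * q 0 ord_max.
Proof.
by rewrite /dot big_ord_recr/=; congr (_ + _); apply: eq_bigr => i _; rewrite !mxE.
Qed.

Lemma dot_snoc a b t u : dot (snoc a b) (snoc t u) = dot a t + b * u.
Proof. by rewrite dot_recr !body_snoc !snoc_max. Qed.

Lemma snocD a b t u : snoc a b + snoc t u = snoc (a + t) (b + u).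
Proof. by apply/rowP => i; rewrite !mxE; case: unlift => [j|] //=; rewrite mxE. Qed.

Lemma snocZ l a b : l *: snoc a b = snoc (l *: a) (l * b).
Proof. by apply/rowP => i; rewrite !mxE; case: unlift => [j|] //=; rewrite mxE. Qed.

Lemma continuous_body : continuous body.
Proof.
move=> p A /= /nbhs_ballP[e e0 eA]; apply/nbhs_ballP; exists e => //= q [_ pq].
by apply: eA; split => // i j; rewrite !mxE; exact: pq.
Qed.

End snoc.

Section conjugacy.
Variables (R : realType) (n : nat) (f : 'rV[R]_n -> \bar R).
Hypotheses (f_convex : convex_ereal f) (f_closed : closed_function f).

(** The vector [snoc a b] stands for the affine function [t |-> <a, t> + b].
    Encoding it by a vector makes its homogenization the linear form
    [dot (snoc a b)]. *)
Definition minorants : set 'rV[R]_n.+1 :=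
  [set c | forall t, (dot c (snoc t 1%R))%:E <= f t].

Definition epi_row : set 'rV[R]_n.+1 :=
  [set z | f (body z) <= (z 0 ord_max)%:E].

Lemma dom_fine t : dom f t -> f t = (fine (f t))%:E.
Proof.
move=> dt; rewrite fineK// fin_numE f_convex.1/=.
by apply: contraTneq dt => ft; apply/negP; rewrite /dom /= ft.
Qed.

Lemma epi_row_snoc t r : epi_row (snoc t r) = (f t <= r%:E) :> Prop.
Proof. by rewrite /epi_row /= body_snoc snoc_max. Qed.

Lemma closed_epi_row : closed epi_row.
Proof.
apply: (@preimage_closed _ _ (fun z => (body z, z 0%R ord_max)) (epigraph f)) => //.
move=> z _.
exact: (cvg_pair (@continuous_body R n z)
  (@coord_continuous R 1 n.+1 ord0 ord_max z)).
Qed.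

Lemma convex_epi_row : convex epi_row.
Proof.
move=> x y l l01 Ex Ey; rewrite /epi_row /=.
have -> : body (l *: x + (1 - l) *: y) = (l *: body x + (1 - l) *: body y)%R.
  by apply/rowP => i; rewrite !mxE.
apply: le_trans (f_convex.2 _ _ _ l01) _.
rewrite !mxE [leRHS]EFinD !EFinM; apply: leeD; apply: lee_wpmul2l => //.
  by case/andP: l01.
by rewrite lee_fin subr_ge0; case/andP: l01.
Qed.

(** Project [(t0, r0)] on the epigraph, at [(y, b)]; take [a = t0 - y] and
    [r = dot a y].
    The epigraph is unbounded upwards, whence [r0 <= b]; the distance
    [dot a a + (b - r0)^2] is positive because [(t0, r0)] lies outside. *)
Lemma separate_epi t0 r0 : dom f !=set0 -> ~ (f t0 <= r0%:E) ->
  exists a r b, [/\ (r0 <= b)%R, (0 < dot a a + (b - r0) ^+ 2)%R,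
    (r = dot a t0 - dot a a)%R &
    forall t s, f t <= s%:E -> (dot a t - r <= (b - r0) * (s - b))%R].
Proof.
move=> [t1 dt1] ft0.
have [s1 fs1] : exists s1, f t1 <= s1%:E.
  by exists (fine (f t1)); rewrite -dom_fine.
have [] := closed_convex_projection (snoc t0 r0) closed_epi_row convex_epi_row.
  by exists (snoc t1 s1); rewrite epi_row_snoc.
move=> y Ey ymin; rewrite -(snoc_body y) in Ey ymin.
move: (body y) (y 0%R ord_max) Ey ymin => yb yr; rewrite epi_row_snoc => Ey ymin.
have sB a b t u : (snoc a b - snoc t u = @snoc R n (a - t) (b - u))%R.
  by rewrite -scaleN1r snocZ snocD scaleN1r mulN1r.
have key t s : f t <= s%:E ->
    (dot (t - yb) (t0 - yb) + (s - yr) * (r0 - yr) <= 0)%R.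
  by move=> fts; have := ymin (snoc t s); rewrite !sB dot_snoc epi_row_snoc; apply.
exists (t0 - yb)%R, (dot (t0 - yb) yb), yr; split.
- rewrite leNgt; apply/negP => yr0.
  have := key yb (yr + 1)%R; rewrite subrr.
  rewrite /dot big1 => [|i _]; last by rewrite !mxE mul0r.
  move=> H; have : f yb <= (yr + 1)%:E by apply: le_trans Ey _; rewrite lee_fin lerDl.
  by move=> /H; lra.
- rewrite lt_neqAle addr_ge0 ?dot_sqr_ge0 ?sqr_ge0// andbT eq_sym.
  rewrite paddr_eq0 ?dot_sqr_ge0 ?sqr_ge0//; apply/negP => /andP[/eqP /dot_sqr_eq0].
  move=> /subr0_eq e; rewrite sqrf_eq0 subr_eq0 => /eqP e'.
  by apply: ft0; rewrite e -e'.
- by rewrite -dotBr subKr.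
- move=> t s /key; rewrite dotBl !(dotC _ (t0 - yb)%R) => ?; lra.
Qed.

(** When [r0 < b] the separating hyperplane is not vertical: solving its
    equation for the last coordinate gives an affine minorant. *)
Lemma nonvertical_minorant t0 r0 a r b : (r0 < b)%R ->
    r = (dot a t0 - dot a a)%R ->
    (forall t s, f t <= s%:E -> (dot a t - r <= (b - r0) * (s - b))%R) ->
  exists2 c, minorants c & (r0 <= dot c (snoc t0 1))%R.
Proof.
rewrite -subr_gt0 => br rE sep.
exists (snoc ((b - r0)^-1 *: a) (b - (b - r0)^-1 * r)).
  move=> t; rewrite dot_snoc dotZl mulr1.
  have [->|ft] := eqVneq (f t) +oo; first by rewrite leey.
  have {}ft : dom f t by rewrite /dom /= ltey.
  rewrite (dom_fine ft) lee_fin; have := sep t (fine (f t)).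
  rewrite -(dom_fine ft) lexx => /(_ isT).
  rewrite mulrC -ler_pdivrMr// mulrBl mulrC [(r / _)%R]mulrC; lra.
rewrite dot_snoc dotZl mulr1 rE.
have -> : ((b - r0)^-1 * dot a t0 + (b - (b - r0)^-1 * (dot a t0 - dot a a)) =
  b + (b - r0)^-1 * dot a a)%R by ring.
have : (0 <= (b - r0)^-1 * dot a a)%R.
  by rewrite mulr_ge0 ?dot_sqr_ge0// invr_ge0 ltW.
lra.
Qed.

(** Above a point of the domain the hyperplane is never vertical: with [r0 = b],
    the inequality at [t0] itself would give [dot a a <= 0]. *)
Lemma dom_minorant t0 r0 : dom f t0 -> ~ (f t0 <= r0%:E) ->
  exists2 c, minorants c & (r0 <= dot c (snoc t0 1))%R.
Proof.
move=> dt0 ft0; have [a [r [b [rb ab0 rE sep]]]] := separate_epi (ex_intro _ t0 dt0) ft0.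
apply: (nonvertical_minorant _ rE sep).
rewrite lt_neqAle rb andbT; apply/eqP => br.
move: ab0 (sep t0 (fine (f t0))); rewrite -br -(dom_fine dt0) lexx => ab0 /(_ isT).
by rewrite rE; lra.
Qed.

Lemma minorants_neq0 : dom f !=set0 -> minorants !=set0.
Proof.
move=> [t dt].
have ft := dom_fine dt.
have [|c Mc _] := @dom_minorant t (fine (f t) - 1)%R dt; last by exists c.
by rewrite ft lee_fin; apply/negP; rewrite -ltNge; lra.
Qed.

(** Outside the domain the hyperplane may be vertical.  Then [dot a t - r] is
    nonpositive on the domain and positive at [t0]: adding a large multiple of
    it to any minorant gives minorants that are arbitrarily large at [t0]. *)
Lemma minorant_above t0 r0 : dom f !=set0 -> r0%:E < f t0 ->
  exists2 c, minorants c & (r0 <= dot c (snoc t0 1))%R.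
Proof.
move=> df ft0; have nft0 : ~ (f t0 <= r0%:E) by apply/negP; rewrite -ltNge.
have [dt0|ndt0] := pselect (dom f t0); first exact: dom_minorant.
have [a [r [b [rb ab0 rE sep]]]] := separate_epi df nft0.
move: rb; rewrite le_eqVlt => /predU1P[br|rb]; last first.
  exact: (nonvertical_minorant _ rE sep).
move: ab0 sep; rewrite -br subrr expr0n/= addr0 => aa0 sep.
have [c Mc] := minorants_neq0 df.
pose l := (`|r0 - dot c (snoc t0 1)| / dot a a)%R.
have l0 : (0 <= l)%R by rewrite divr_ge0// ltW.
exists (c + l *: snoc a (- r)%R)%R.
  move=> t; rewrite dotDl dotZl dot_snoc mulr1.
  have [->|ft] := eqVneq (f t) +oo; first by rewrite leey.
  have {}ft : dom f t by rewrite /dom /= ltey.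
  have := sep t (fine (f t)); rewrite -(dom_fine ft) lexx mul0r => /(_ isT) ar.
  apply: le_trans (Mc t); rewrite lee_fin gerDl mulr_ge0_le0//.
rewrite dotDl dotZl dot_snoc mulr1 rE.
have -> : (dot a t0 + - (dot a t0 - dot a a) = dot a a)%R by ring.
rewrite divfK ?gt_eqF//; have := ler_norm (r0 - dot c (snoc t0 1%R))%R; lra.
Qed.

Lemma fenchel_moreau t : dom f !=set0 ->
  f t = ereal_sup [set (dot c (snoc t 1%R))%:E | c in minorants].
Proof.
move=> df; apply/eqP; rewrite eq_le; apply/andP; split; last first.
  by apply: ge_ereal_sup => _ [c Mc <-]; exact: Mc.
rewrite leNgt; apply/negP => lt_f.
have [r /andP[supr rf]] : exists r : R,
    ereal_sup [set (dot c (snoc t 1%R))%:E | c in minorants] < r%:E < f t.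
  have [c Mc] := minorants_neq0 df.
  have supc : (dot c (snoc t 1%R))%:E <=
      ereal_sup [set (dot c (snoc t 1%R))%:E | c in minorants].
    by apply: ereal_sup_ubound; exists c.
  move: lt_f supc; case: ereal_sup => [s||]; last 2 first.
  - by rewrite ltNge leey.
  - by rewrite leeNy_eq.
  case: (f t) => [v||]//.
    rewrite lte_fin => sv _; exists ((s + v) / 2)%R.
    by rewrite !lte_fin; apply/andP; split; lra.
  by move=> _ _; exists (s + 1)%R; rewrite lte_fin ltrDl ltr01 ltry.
have [c Mc rc] := minorant_above df rf.
move: supr; apply/negP; rewrite -leNgt; apply: le_trans (_ : (dot c (snoc t 1%R))%:E <= _).
  by rewrite lee_fin.
by apply: ereal_sup_ubound; exists c.
Qed.

End conjugacy.

(** * Relative interiors of convex sets *)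

Section relint.
Variables (R : realType) (n : nat).
Local Open Scope ring_scope.

(** Weights of total mass at most 1: the missing mass goes to [x0]. *)
Lemma convex_combination (C : set 'rV[R]_n) (x0 : 'rV[R]_n) (I : eqType)
    (s : seq I) (l : I -> R) (d : I -> 'rV[R]_n) :
  convex C -> C x0 -> (forall i, C (x0 + d i)) -> (forall i, 0 <= l i) ->
  \sum_(i <- s) l i <= 1 -> C (x0 + \sum_(i <- s) l i *: d i).
Proof.
move=> Cco Cx0 Cd; elim: s l => [|i s IH] l l0 l1; first by rewrite big_nil addr0.
have ls0 : 0 <= \sum_(j <- s) l j by exact: sumr_ge0.
have li0 := l0 i.
rewrite !big_cons in l1 *.
have li1 : l i <= 1 by lra.
(* When l i = 1 the remaining weights vanish, and so do their quotients by
   1 - l i, which is 0. *)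
have -> : x0 + (l i *: d i + \sum_(j <- s) l j *: d j) =
    l i *: (x0 + d i) + (1 - l i) *: (x0 + \sum_(j <- s) (l j / (1 - l i)) *: d j).
  have -> : (1 - l i) *: (x0 + \sum_(j <- s) (l j / (1 - l i)) *: d j) =
      (1 - l i) *: x0 + \sum_(j <- s) l j *: d j.
    rewrite scalerDr; congr (_ + _); have [li|li] := eqVneq (1 - l i) 0.
      have /allP ls : all (fun j => l j == 0) s.
        by rewrite -(@psumr_eq0 _ _ _ xpredT)// eq_le ls0 andbT; lra.
      rewrite li scale0r big_seq big1// => j js.
      by rewrite (eqP (ls j js)) scale0r.
    rewrite scaler_sumr; apply: eq_bigr => j _; rewrite scalerA; congr (_ *: _).
    by rewrite mulrC divfK.
  rewrite scalerDr addrACA -scalerDl [l i + _]addrC subrK scale1r.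
  by rewrite [RHS]addrA [X in _ = X]addrC; apply/rowP => k; rewrite !mxE; ring.
apply: Cco => //; first by rewrite li0.
apply: IH => [j|]; first by rewrite divr_ge0// subr_ge0.
rewrite -mulr_suml; have [->|li] := eqVneq (1 - l i) 0; first by rewrite invr0 mulr0.
have : 0 <= 1 - l i by rewrite subr_ge0.
by rewrite le_eqVlt eq_sym (negbTE li)/= => ?; rewrite ler_pdivrMr// mul1r; lra.
Qed.

(** Take a largest linearly independent family of directions [D_i] with
    [x0 + D_i] in [C].  By maximality the affine hull of [C] lies in the
    translate by [x0] of their span; near the barycentre of [x0] and the
    [x0 + D_i], its points keep positive barycentric coordinates and so belong
    to [C]. *)
Lemma relint_neq0 (C : set 'rV[R]_n) : convex C -> C !=set0 -> relint C !=set0.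
Proof.
move=> Cco [x0 Cx0].
pose P r := `[< exists D : 'M[R]_(r, n),
  row_free D /\ forall i, C (x0 + row i D) >].
have P0 : exists r, P r.
  exists 0%N; apply/asboolP; exists 0; split; first by rewrite -row_leq_rank.
  by case.
have Pn r : P r -> (r <= n)%N.
  by move=> /asboolP[D [/eqP rD _]]; rewrite -[leqLHS]rD rank_leq_col.
case: (ex_maxnP P0 Pn) => r /asboolP[D [Dfree CD]] rmax {P0 Pn}.
have CsubD x : C x -> (x - x0 <= D)%MS.
  move=> Cx; apply/negPn/negP => nxD.
  have : P (r + 1)%N.
    apply/asboolP; exists (col_mx D (x - x0)); split.
      apply: inj_row_free => v; rewrite -(hsubmxK v) mul_row_col => v0.
      have v2 : rsubmx v = (rsubmx v 0 0)%:M by rewrite -mx11_scalar.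
      have [rv0|rv0] := eqVneq (rsubmx v 0 0) 0.
        move: v0; rewrite v2 rv0 raddf0 mul0mx addr0 => /eqP.
        by rewrite mulmx_free_eq0// => /eqP ->; rewrite row_mx0.
      case/negP: nxD.
      have -> : x - x0 = (- (rsubmx v 0 0)^-1 *: lsubmx v) *m D.
        move: v0; rewrite v2 mul_scalar_mx => /eqP; rewrite addrC addr_eq0 => /eqP e.
        rewrite -scalemxAl scaleNr -scalerN -e mxE eqxx mulr1n scalerA mulVf// ?scale1r//.
      exact: submxMl.
    move=> i; rewrite -(splitK i); case: (fintype.split i) => j /=.
      by rewrite rowKu.
    by rewrite rowKd row_id addrC subrK.
  by move=> /rmax; rewrite addn1 ltnn.
have hullD y : affine_hull C y -> (y - x0 <= D)%MS.
  move=> Hy; apply: (Hy [set y | (y - x0 <= D)%MS]); split; last exact: CsubD.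
  move=> u v l /= uD vD.
  have -> : l *: u + (1 - l) *: v - x0 = l *: (u - x0) + (1 - l) *: (v - x0).
    by apply/rowP => k; rewrite !mxE; ring.
  by rewrite addmx_sub// scalemx_sub.
pose rho : R := r.+1%:R^-1.
have rho0 : 0 < rho by rewrite invr_gt0.
have rrho : r%:R * rho = 1 - rho.
  have : (r%:R + 1) * rho = 1 by rewrite natr1 mulfV ?pnatr_eq0.
  lra.
have comb w : (forall i, 0 <= w i) -> \sum_i w i <= 1 ->
    C (x0 + \sum_i w i *: row i D).
  by move=> w0 w1; apply: convex_combination.
exists (x0 + \sum_(i < r) rho *: row i D); split.
  apply: comb => [_|]; first exact: ltW.
  by rewrite sumr_const card_ord -mulr_natl rrho; lra.
set xb := x0 + _.
(* The coordinates w of y - xb in the basis D depend linearly on y, through Q,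
   so they are bounded by a multiple B of the norm of y - xb. *)
pose Q := pinvmx D; pose B := 1 + \sum_i \sum_j `|Q j i|.
have B0 : 0 < B by rewrite ltr_pwDl// sumr_ge0// => i _; rewrite sumr_ge0.
apply/nbhs_ballP; exists (rho ^+ 2 / B) => /=; first by rewrite divr_gt0// exprn_gt0.
move=> y; rewrite -ball_normE/= distrC => ye /hullD yD.
pose w := (y - xb) *m Q.
have wE : y - xb = w *m D.
  rewrite mulmxKpV// /xb opprD addrA addmx_sub//.
  rewrite -scaleN1r scalemx_sub// summx_sub// => i _.
  by rewrite scalemx_sub// row_sub.
have wle i : `|w 0 i| <= rho ^+ 2.
  have -> : w 0 i = dot (y - xb) (\row_j Q j i).
    by rewrite mxE; apply: eq_bigr => j _; rewrite !mxE.
  apply: le_trans (dot_le_norm _ _) _.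
  have Bi : \sum_j `|(\row_j Q j i) 0 j| <= B.
    rewrite /B (bigD1 i)//= addrCA.
    under eq_bigr do rewrite mxE.
    rewrite lerDl addr_ge0// sumr_ge0// => k _; exact: sumr_ge0.
  apply: le_trans (ler_wpM2l (normr_ge0 _) Bi) _.
  by rewrite -ler_pdivlMr// ltW.
have -> : y = x0 + \sum_i (rho + w 0 i) *: row i D.
  under eq_bigr do rewrite scalerDl.
  by rewrite big_split/= addrA -mulmx_sum_row -wE addrC subrK.
have rho1 : rho <= 1 by rewrite invf_le1// ler1n.
apply: comb => [i|].
  have := wle i; rewrite ler_norml expr2 => /andP[+ _]; nra.
apply: le_trans (_ : \sum_(i < r) (rho + rho ^+ 2) <= _).
  by apply: ler_sum => i _; rewrite lerD2l; apply: le_trans (wle i); exact: ler_norm.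
rewrite sumr_const card_ord -mulr_natl mulrDr expr2 mulrA rrho; nra.
Qed.

End relint.

(** * The closed perspective as a support function *)

Section perspective.
Variables (R : realType) (n : nat) (f : 'rV[R]_n -> \bar R).
Hypotheses (f_convex : convex_ereal f) (f_closed : closed_function f).
Hypothesis df : dom f !=set0.

(** The support function of the set of minorants; it turns out to be the closed
    perspective of [f]. *)
Definition minorant_support (p : 'rV[R]_n.+1) : \bar R :=
  ereal_sup [set (dot c p)%:E | c in minorants f].

Lemma minorant_support_ge c p : minorants f c -> (dot c p)%:E <= minorant_support p.
Proof. by move=> Mc; apply: ereal_sup_ubound; exists c. Qed.

Lemma minorant_support_le p e : (forall c, minorants f c -> (dot c p)%:E <= e) ->
  minorant_support p <= e.
Proof. by move=> H; apply: ge_ereal_sup => _ [c Mc <-]; exact: H. Qed.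

Lemma minorant_support_gtNy p : -oo < minorant_support p.
Proof.
have [c Mc] := minorants_neq0 f_convex f_closed df.
by apply: lt_le_trans (minorant_support_ge p Mc); exact: ltNyr.
Qed.

Lemma minorant_supportZ (r : R) p : (0 <= r)%R ->
  minorant_support (r *: p) = r%:E * minorant_support p.
Proof.
move=> r0; rewrite /minorant_support -ereal_supZl//; last first.
  have [c Mc] := minorants_neq0 f_convex f_closed df.
  by apply/set0P; exists (dot c p)%:E; exists c.
rewrite image_comp; congr ereal_sup; apply: eq_imagel => c _ /=.
by rewrite dotZr EFinM.
Qed.

Lemma minorant_support_snoc1 t : minorant_support (snoc t 1%R) = f t.
Proof. by rewrite [RHS](fenchel_moreau f_convex f_closed _ df). Qed.

Lemma convex_dom : convex (dom f).
Proof.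
move=> x y l /andP[l0 l1] dx dy; rewrite /dom /=.
apply: le_lt_trans (f_convex.2 x y l _) _; first by rewrite l0.
by rewrite (dom_fine f_convex dx) (dom_fine f_convex dy) -!EFinM -EFinD ltry.
Qed.

(** Along the ray, each minorant [snoc a b] bounds [s f (t' - t + t / s)] from
    below by [<a, t> + O(s)].  From above, every minorant grows along [t] at
    most at the rate [v], the supremum of the slopes [<a, t>], so that
    [f (t' - t + t / s) <= f t' + (1 / s - 1) v]. *)
Lemma cvg_recession t t' : dom f t' ->
  s%:E * f (t' - t + s^-1 *: t)%R @[s --> 0%R^'+] --> minorant_support (snoc t 0%R).
Proof.
move=> dt'.
have lower c : minorants f c -> forall s : R, (0 < s)%R ->
    (s * dot c (snoc (t' - t) 1) + dot c (snoc t 0))%:E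
    <= s%:E * f (t' - t + s^-1 *: t)%R.
  move=> Mc s s0; apply: (le_trans (y := s%:E * (dot c (snoc (t' - t + s^-1 *: t) 1))%:E)).
    rewrite -EFinM lee_fin -!dotZr -dotDr !snocZ snocD mulr1 addr0.
    have -> : (s *: (t' - t + s^-1 *: t) = s *: (t' - t) + t)%R => //.
    by rewrite [LHS]scalerDr scalerA mulfV ?gt_eqF// scale1r.
  by rewrite lee_wpmul2l ?lee_fin ?(ltW s0)//; exact: Mc.
have small (K e : R) : (0 < e)%R -> \forall s \near 0%R^'+, (`|s * K| <= e)%R.
  move=> e0; near=> s.
  have s0 : (0 < s)%R by near: s; exact: nbhs_right_gt.
  have sK : (s <= e / (1 + `|K|))%R.
    by near: s; apply: nbhs_right_le; rewrite divr_gt0// ltr_pwDl.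
  rewrite normrM (gtr0_norm s0).
  have : (0 < 1 + `|K|)%R by rewrite ltr_pwDl.
  move=> K0; move: sK; rewrite ler_pdivlMr// mulrDr mulr1; lra.
have [supy|supy] := eqVneq (minorant_support (snoc t 0%R)) +oo.
  rewrite supy; apply/cvgeyPge => A.
  have : (A + 1)%:E < minorant_support (snoc t 0%R) by rewrite supy ltry.
  move=> /ereal_sup_gt[_ [c Mc <-]]; rewrite lte_fin => Ac.
  near=> s.
  have s0 : (0 < s)%R by near: s; exact: nbhs_right_gt.
  apply: le_trans (lower c Mc s s0); rewrite lee_fin.
  have : (`|s * dot c (snoc (t' - t) 1%R)| <= 1)%R by near: s; exact: small.
  by rewrite ler_norml => /andP[+ _]; lra.
set v := fine (minorant_support (snoc t 0%R)).
have vE : minorant_support (snoc t 0%R) = v%:E.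
  by rewrite fineK// fin_numE supy gt_eqF// minorant_support_gtNy.
have upper (s : R) : (0 < s <= 1)%R ->
    s%:E * f (t' - t + s^-1 *: t)%R <= (v + s * (fine (f t') - v))%:E.
  move=> /andP[s0 s1]; rewrite -minorant_support_snoc1 -minorant_supportZ; last exact: ltW.
  apply: minorant_support_le => c Mc.
  rewrite snocZ mulr1 scalerDr scalerA mulfV ?gt_eqF// scale1r.
  have -> : snoc (s *: (t' - t) + t) s = (s *: snoc t' 1 + (1 - s) *: snoc t 0)%R.
    rewrite !snocZ snocD mulr1 mulr0 addr0; congr snoc.
    by apply/rowP => i; rewrite !mxE; ring.
  rewrite dotDr !dotZr lee_fin.
  have h1 : (dot c (snoc t' 1) <= fine (f t'))%R.
    by rewrite -lee_fin -(dom_fine f_convex dt'); exact: Mc.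
  have h2 : (dot c (snoc t 0) <= v)%R by rewrite -lee_fin -vE; exact: minorant_support_ge.
  by nra.
have fin (s : R) : (0 < s <= 1)%R ->
    s%:E * f (t' - t + s^-1 *: t)%R = (fine (s%:E * f (t' - t + s^-1 *: t)%R))%:E.
  move=> s01; rewrite fineK// fin_numElt (le_lt_trans (upper s s01)) ?ltry// andbT.
  have [c Mc] := minorants_neq0 f_convex f_closed df.
  by case/andP: s01 => s0 _; apply: lt_le_trans (lower c Mc s s0); exact: ltNyr.
rewrite vE; apply/fine_cvgP; split.
  near=> s; rewrite fin// ; apply/andP; split.
    by near: s; exact: nbhs_right_gt.
  by near: s; exact: nbhs_right_le.
apply/cvgrPdist_le => e e0.
have : (v - e / 2)%:E < minorant_support (snoc t 0%R).
  by rewrite vE lte_fin; lra.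
move=> /ereal_sup_gt[_ [c Mc <-]]; rewrite lte_fin => vc.
near=> s => /=.
have s0 : (0 < s)%R by near: s; exact: nbhs_right_gt.
have s01 : (0 < s <= 1)%R.
  by rewrite s0/=; near: s; exact: nbhs_right_le.
have := lower c Mc s s0; have := upper s s01; rewrite (fin s s01) !lee_fin/=.
set w := fine _.
have : (`|s * dot c (snoc (t' - t) 1%R)| <= e / 2)%R.
  by near: s; apply: small; rewrite divr_gt0.
have : (`|s * (fine (f t') - v)| <= e)%R by near: s; exact: small.
rewrite !ler_norml => /andP[? ?] /andP[? ?] ? ?; apply/andP; split; lra.
Unshelve. all: by end_near. Qed.

(** The relative interior is nonempty, so that the point [t'] picked in the
    definition of the closed perspective does lie in the domain. *)
Lemma closed_perspectiveE t u :
  closed_perspective f t u = minorant_support (snoc t (Num.max u 0%R)).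
Proof.
rewrite /closed_perspective; case: ifPn => [u0|]; last first.
  rewrite -leNgt => u0; rewrite max_r//; apply/cvg_lim => //.
  apply: cvg_recession.
  by have /(@getPex _ (relint (dom f)))[] := relint_neq0 convex_dom df.
rewrite max_l ?(ltW u0)// -minorant_support_snoc1 -minorant_supportZ ?(ltW u0)//.
by rewrite snocZ mulr1 scalerA mulfV ?gt_eqF// scale1r.
Qed.

End perspective.

(** * The losses, their entropy and the biconjugate formula *)

Section conjugate.
Variables (R : realType) (n : nat) (f : 'rV[R]_n -> \bar R).
Hypotheses (f_convex : convex_ereal f) (f_closed : closed_function f).
Hypothesis f1 : f (const_mx 1%R) = 0.

Local Notation k := (n.+1%:R : R)%R.
Local Notation ones := (const_mx 1%R : 'rV[R]_n.+1).
Implicit Types (a b p c x : 'rV[R]_n.+1) (t : 'rV[R]_n).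

Lemma dom_ones : dom f !=set0.
Proof. by exists (const_mx 1%R); rewrite /dom /= f1 ltry. Qed.

Let support_gtNy := minorant_support_gtNy f_convex f_closed dom_ones.
Let supportZ := minorant_supportZ f_convex f_closed dom_ones.

Let k_gt0 : (0 < k)%R. Proof. exact: ltr0Sn. Qed.
Hint Resolve k_gt0 : core.

Lemma perspective_support p : (0 <= p 0 ord_max)%R ->
  closed_perspective f (body p) (p 0 ord_max)%R = minorant_support f p.
Proof.
move=> p0; rewrite closed_perspectiveE//; last exact: dom_ones.
by rewrite max_l// snoc_body.
Qed.

Lemma minorant_support_ones : minorant_support f ones = 0.
Proof.
rewrite -f1 -(minorant_support_snoc1 f_convex f_closed dom_ones); congr minorant_support.
by apply/rowP => i; rewrite !mxE; case: unlift => [j|] //=; rewrite mxE.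
Qed.

(** The supremum in the definition of the loss, as a real number: it is finite
    by [conjugate_fin]. *)
Definition conjugate (a : 'rV[R]_n.+1) : R :=
  fine (ereal_sup [set (dot p a)%:E - k%:E * minorant_support f p | p in @simplex R n]).

Lemma simplex_ge0 p : @simplex R n p -> forall i, (0 <= p 0 i)%R.
Proof. by case. Qed.

Lemma uniform_simplex : simplex (uniform_prior R n).
Proof.
split=> [i|]; first by rewrite mxE invr_ge0.
under eq_bigr do rewrite mxE.
by rewrite sumr_const card_ord -[LHS]mulr_natl mulfV// gt_eqF.
Qed.

Lemma minorant_support_uniform : minorant_support f (uniform_prior R n) = 0.
Proof.
have -> : uniform_prior R n = (k^-1 *: ones)%R.
  by apply/rowP => i; rewrite !mxE mulr1.
by rewrite supportZ ?minorant_support_ones ?mule0// invr_ge0.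
Qed.

(** The uniform distribution, where the support function vanishes, bounds the
    supremum from below; any minorant of [f] bounds it from above, because the
    simplex is bounded. *)
Lemma conjugate_fin a :
  ereal_sup [set (dot p a)%:E - k%:E * minorant_support f p | p in @simplex R n]
  = (conjugate a)%:E.
Proof.
rewrite fineK// fin_numElt; apply/andP; split.
  apply: (lt_le_trans (y := (dot (uniform_prior R n) a)%:E)); first exact: ltNyr.
  apply: ereal_sup_ubound; exists (uniform_prior R n); first exact: uniform_simplex.
  by rewrite minorant_support_uniform mule0 sube0.
have [c Mc] := minorants_neq0 f_convex f_closed dom_ones.
pose b := (\sum_i `|a 0 i - k * c 0 i|)%R.
apply: (le_lt_trans (y := b%:E)); last exact: ltry.
apply: ge_ereal_sup => _ [p [p0 p1] <-].
apply: (le_trans (y := (dot p a)%:E - k%:E * (dot c p)%:E)).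
  by rewrite leeB// lee_wpmul2l ?lee_fin ?(ltW k_gt0)//; exact: minorant_support_ge.
rewrite -EFinM -EFinB lee_fin (dotC c) -dotZr -dotBr.
apply: ler_sum => i _; rewrite !mxE.
apply: le_trans (ler_norm _) _; rewrite normrM ger0_norm// ler_piMl//.
rewrite -p1 (bigD1 i)//= lerDl; exact: sumr_ge0.
Qed.

Lemma conjugate_ge p a : simplex p ->
  (dot p a - conjugate a)%:E <= k%:E * minorant_support f p.
Proof.
move=> sp.
have : (dot p a)%:E - k%:E * minorant_support f p <= (conjugate a)%:E.
  by rewrite -conjugate_fin; apply: ereal_sup_ubound; exists p.
have := support_gtNy p; case: (minorant_support f p) => [s||]//=.
  by move=> _; rewrite -EFinM -EFinB !lee_fin; lra.
by move=> _ _; rewrite mulry gtr0_sg// mul1e leey.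
Qed.

Lemma conjugate_le r a :
  (forall p, simplex p -> (dot p a - r)%:E <= k%:E * minorant_support f p) ->
  (conjugate a <= r)%R.
Proof.
move=> H; rewrite -lee_fin -conjugate_fin; apply: ge_ereal_sup => _ [p sp <-].
have := H p sp; have := support_gtNy p; case: (minorant_support f p) => [s||]//=.
  by move=> _; rewrite -EFinM -EFinB !lee_fin; lra.
by move=> _ _; rewrite mulry gtr0_sg// mul1e/= addeNy leNye.
Qed.

(** Both sides are positively homogeneous in [p], which reduces the inequality
    to the simplex, where it is the definition of the conjugate. *)
Lemma fenchel_young p a : (forall i, 0 <= p 0 i)%R ->
  (dot p a - (\sum_i p 0 i) * conjugate a)%:E <= k%:E * minorant_support f p.
Proof.
move=> p0; set s := (\sum_i p 0 i)%R.
have s0 : (0 <= s)%R by exact: sumr_ge0.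
have [{}s0|sn0] := eqVneq s 0%R.
  have -> : p = (0 *: p)%R.
    apply/rowP => i; rewrite scale0r mxE.
    by apply: (psumr_eq0P (P := xpredT) _ s0) => // j _; exact: p0.
  by rewrite supportZ// mul0e mule0 dotZl s0 !mul0r subr0.
have sp0 : (0 < s)%R by rewrite lt_neqAle eq_sym sn0.
have sp : simplex (s^-1 *: p)%R.
  split=> [i|]; first by rewrite mxE mulr_ge0// invr_ge0.
  by under eq_bigr do rewrite mxE; rewrite -mulr_sumr mulVf.
have -> : p = (s *: (s^-1 *: p))%R by rewrite scalerA mulfV// scale1r.
rewrite supportZ// dotZl -mulrBr EFinM muleCA.
by rewrite lee_wpmul2l ?lee_fin//; exact: conjugate_ge.
Qed.

(** The near-optimal scores: [<p, k c> <= k (minorant_support p)] on the whole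
    simplex, since [c] is one of the minorants. *)
Lemma conjugate_minorant c : minorants f c -> (conjugate (k *: c) <= 0)%R.
Proof.
move=> Mc; apply: conjugate_le => p sp; rewrite subr0 dotZr dotC EFinM.
by rewrite lee_wpmul2l ?lee_fin ?(ltW k_gt0)//; exact: minorant_support_ge.
Qed.

Lemma lossE a i : loss f a i = (conjugate a - a 0 i)%:E.
Proof.
rewrite EFinB addeC -conjugate_fin /loss; congr (_ + ereal_sup _).
apply: eq_imagel => p sp; rewrite perspective_support//.
exact: simplex_ge0.
Qed.

Lemma conjugate_convex a b (l : R) : (0 <= l <= 1)%R ->
  (conjugate (l *: a + (1 - l) *: b) <= l * conjugate a + (1 - l) * conjugate b)%R.
Proof.
move=> /andP[l0 l1]; have l1' : (0 <= 1 - l)%R by rewrite subr_ge0.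
apply: conjugate_le => p sp.
have := conjugate_ge a sp; have := conjugate_ge b sp; have := support_gtNy p.
case: (minorant_support f p) => [s||]//=; last by rewrite mulry gtr0_sg// mul1e !leey.
move=> _; rewrite -!EFinM !lee_fin dotDr !dotZr; nra.
Qed.

Lemma loss_convex i : convex_ereal (fun a => loss f a i).
Proof.
split=> [a|a b l l01]; first by rewrite lossE.
rewrite !lossE -!EFinM -EFinD lee_fin !mxE.
have := conjugate_convex a b l01; lra.
Qed.

Lemma sum_loss (x a : 'rV[R]_n.+1) :
  \sum_i (x 0 i)%:E * loss f a i =
  ((\sum_i x 0 i) * conjugate a - dot x a)%:E.
Proof.
under eq_bigr do rewrite lossE -EFinM mulrBr.
by rewrite sumEFin big_split/= sumrN -mulr_suml.
Qed.

Lemma sum_uniform_loss a :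
  \sum_i (uniform_prior R n 0 i)%:E * loss f a i =
  (conjugate a - k^-1 * dot ones a)%:E.
Proof.
rewrite sum_loss uniform_simplex.2 mul1r; congr (_ - _)%:E.
by rewrite -dotZl; congr dot; apply/rowP => i; rewrite !mxE mulr1.
Qed.

(** Fenchel-Young at the vector of ones, where the support function is
    [f 1 = 0], gives [0 <= entropy]; scores [k c], with [c] a minorant of [f]
    nearly tight at 1, give the converse. *)
Lemma entropy_uniform : entropy (loss f) (uniform_prior R n) = 0.
Proof.
apply/eqP; rewrite eq_le; apply/andP; split.
  apply/lee_addgt0Pr => e e0; rewrite add0e.
  have : (- e)%:E < minorant_support f ones by rewrite minorant_support_ones lte_fin; lra.
  move=> /ereal_sup_gt[_ [c Mc <-]]; rewrite lte_fin => ec.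
  apply: (le_trans (y := (conjugate (k *: c) - k^-1 * dot ones (k *: c))%:E)).
    by apply: ereal_inf_lbound; exists (k *: c)%R => //; rewrite sum_uniform_loss.
  rewrite lee_fin dotZr mulrA mulVf ?gt_eqF// mul1r dotC.
  have := conjugate_minorant Mc; lra.
apply: le_ereal_inf_tmp => _ [a _ <-]; rewrite sum_uniform_loss lee_fin.
have := @fenchel_young ones a; rewrite minorant_support_ones mule0 lee_fin.
under eq_bigr do rewrite mxE; rewrite sumr_const card_ord => /(_ (fun=> _)) H.
have {}H : (dot ones a - k * conjugate a <= 0)%R by apply: H => i; rewrite mxE.
rewrite subr_ge0 mulrC ler_pdivrMr//; lra.
Qed.

(** With [x = (t, 1)], the expression under the supremum is
    [(<x, a> - (sum x) conjugate a) / k].  It is at most [f t] by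
    Fenchel-Young, and the scores [a = k c] reach at least [<c, x>]. *)
Lemma biconjugate (t : 'rV[R]_n) : (forall i, 0 <= t 0 i)%R ->
  f t = ereal_sup
    [set 0 - \sum_(i < n) (uniform_prior R n 0 (inner i))%:E * loss f a (inner i) * (t 0 i)%:E
      - (uniform_prior R n 0 ord_max)%:E * loss f a ord_max
    | a in [set: 'rV[R]_n.+1]].
Proof.
move=> t0; pose x : 'rV[R]_n.+1 := snoc t 1%R.
have x0 i : (0 <= x 0 i)%R.
  by rewrite mxE; case: unlift => //= ?.
have termE a : 0 - \sum_(i < n) (uniform_prior R n 0 (inner i))%:E * loss f a (inner i)
        * (t 0 i)%:E - (uniform_prior R n 0 ord_max)%:E * loss f a ord_max =
    (k^-1 * (dot x a - (\sum_i x 0 i) * conjugate a))%:E.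
  under eq_bigr do rewrite lossE mxE -!EFinM.
  rewrite lossE mxE sumEFin sub0e -EFinM -EFinN -EFinB; congr EFin.
  rewrite /dot !big_ord_recr/= snoc_max.
  under [in RHS]eq_bigr do rewrite snoc_inner.
  under [X in _ = (_ * (_ - (X + _) * _))%R]eq_bigr do rewrite snoc_inner.
  have -> : (\sum_(i < n) k^-1 * (conjugate a - a 0 (inner i)) * t 0 i =
      k^-1 * ((\sum_(i < n) t 0 i) * conjugate a - \sum_(i < n) t 0 i * a 0 (inner i)))%R.
    rewrite mulr_suml -sumrB mulr_sumr; apply: eq_bigr => i _; ring.
  by rewrite -/(inner _); ring.
rewrite -(minorant_support_snoc1 f_convex f_closed dom_ones) -/x.
apply/eqP; rewrite eq_le; apply/andP; split.
  apply: ge_ereal_sup => _ [c Mc <-].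
  apply: (le_trans (y :=
    (k^-1 * (dot x (k *: c) - (\sum_i x 0 i) * conjugate (k *: c)))%:E));
    last first.
    by apply: ereal_sup_ubound; exists (k *: c)%R.

  rewrite lee_fin dotZr mulrBr mulrA mulVf ?gt_eqF// mul1r dotC lerDl oppr_ge0.
  by rewrite mulr_ge0_le0// mulr_ge0_le0 ?conjugate_minorant// sumr_ge0.
apply: ge_ereal_sup => _ [a _ <-]; rewrite termE EFinM.
have -> : minorant_support f x = (k^-1)%:E * (k%:E * minorant_support f x).
  by rewrite muleA -EFinM mulVf ?gt_eqF// mul1e.
by rewrite lee_wpmul2l ?lee_fin//; exact: fenchel_young.
Qed.

End conjugate.

(** * A countable family of affine minorants *)

Section separability.
Variable R : realType.
Local Open Scope ring_scope.

(** Pick a point of [S] in each ball, of rational centre and radius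
    [1 / j.+1], that meets [S]. *)
Lemma dense_sequence n (S : set 'rV[R]_n) : S !=set0 ->
  exists2 s : nat -> 'rV[R]_n, (forall m, S (s m)) &
    forall x e, S x -> 0 < e -> exists m, `|x - s m| <= e.
Proof.
move=> [s0 Ss0].
pose near (z : 'rV[rat]_n * nat) : set 'rV[R]_n :=
  [set y | S y /\ `|y - map_mx ratr z.1| <= z.2.+1%:R^-1].
pose s m := if unpickle m is Some z then xget s0 (near z) else s0.
exists s => [m|x e Sx e0].
  rewrite /s; case: unpickle => [z|]//; case: xgetP => // y _ [].
  by [].
have [j je] : exists j : nat, j.+1%:R^-1 < e / 2.
  have [|j] := @ltr_add_invr R 0 (e / 2); first by rewrite divr_gt0.
  by rewrite add0r; exists j.
have j0 : 0 < j.+1%:R^-1 :> R by rewrite invr_gt0.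
have [q qP] : exists q : 'I_n -> rat, forall i, `|x 0 i - ratr (q i)| <= j.+1%:R^-1.
  apply: (@fin_all_exists _ _ (fun i q => `|x 0 i - ratr q| <= j.+1%:R^-1)) => i.
  have [|r] := @rat_in_itvoo R (x 0 i) (x 0 i + j.+1%:R^-1); first by rewrite ltrDl.
  rewrite in_itv/= => /andP[xr rx]; exists r.
  by rewrite distrC ger0_norm ?subr_ge0 ?(ltW xr)// lerBlDl ltW.
pose z : 'rV[rat]_n * nat := (\row_i q i, j).
have nx : near z x.
  split=> //=; apply/row_normP => [|i]; first exact: ltW.
  by rewrite !mxE.
exists (pickle z); rewrite /s pickleK.
case: xgetP => [y _ [Sy yz]|/(_ x)//].
rewrite (splitr e) -(subrK (map_mx ratr z.1) x) -addrA.
apply: le_trans (ler_normD _ _) _; apply: lerD.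
  by apply: le_trans (ltW je); case: nx.
by rewrite distrC; apply: le_trans (ltW je).
Qed.

End separability.

Section countable_support.
Variables (R : realType) (n : nat) (f : 'rV[R]_n -> \bar R).
Hypotheses (f_convex : convex_ereal f) (f_closed : closed_function f).
Hypothesis df : dom f !=set0.

Lemma countable_minorants : exists2 c : nat -> 'rV[R]_n.+1,
  (forall m, minorants f (c m)) &
  forall p, minorant_support f p = ereal_sup (range (fun m => (dot (c m) p)%:E)).
Proof.
have [c Mc cd] := dense_sequence (minorants_neq0 f_convex f_closed df).
exists c => // p; apply/eqP; rewrite eq_le; apply/andP; split; last first.
  by apply: ge_ereal_sup => _ [m _ <-]; exact: minorant_support_ge.
apply: minorant_support_le => b Mb; apply/lee_addgt0Pr => e e0.
pose K := (1 + \sum_i `|p 0 i|)%R.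
have K0 : (0 < K)%R by rewrite ltr_pwDl// sumr_ge0.
have [|m bm] := cd b (e / K)%R Mb; first by rewrite divr_gt0.
apply: (le_trans (y := (dot (c m) p)%:E + e%:E)); last first.
  by rewrite leeD2r//; apply: ereal_sup_ubound; exists m.
rewrite -EFinD lee_fin -lerBlDl -dotBl.
apply: le_trans (ler_norm _) _; apply: le_trans (dot_le_norm _ _) _.
apply: le_trans (ler_wpM2r _ bm) _; first exact: sumr_ge0.
rewrite -mulrA ler_piMr ?(ltW e0)// mulrC ler_pdivrMr// mul1r lerDr//.
Qed.

End countable_support.

(** * Measurable maximizers over a sequence of linear forms *)

Section running_argmax.
Variables (R : realType) (m : nat) (c : nat -> 'rV[R]_m).
Implicit Type p : 'rV[R]_m.
Local Open Scope ring_scope.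

(** A maximizer of [dot (c m) p] over [m <= N], updated only when [c N] does
    strictly better.  The recursion makes its measurability in [p] an
    induction on [N]. *)
Fixpoint argmax_dot p (N : nat) : nat :=
  if N is M.+1 then
    if dot (c (argmax_dot p M)) p < dot (c N) p then N else argmax_dot p M
  else 0%N.

Definition max_dot p N := dot (c (argmax_dot p N)) p.

Lemma argmax_dot_le p N : (argmax_dot p N <= N)%N.
Proof.
by elim: N => //= N IH; case: ifP => // _; exact: leqW.
Qed.

Lemma max_dotS p N : max_dot p N.+1 = Num.max (max_dot p N) (dot (c N.+1) p).
Proof. by rewrite /max_dot /=; case: ltP. Qed.

Lemma nondecreasing_max_dot p : nondecreasing_seq (max_dot p).
Proof. by apply/nondecreasing_seqP => N; rewrite max_dotS le_max lexx. Qed.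

Lemma dot_le_max p N : dot (c N) p <= max_dot p N.
Proof. by case: N => [|N] //; rewrite max_dotS le_max lexx orbT. Qed.

Lemma cvg_max_dot p :
  (max_dot p N)%:E @[N --> \oo] --> ereal_sup (range (fun N => (dot (c N) p)%:E)).
Proof.
have -> : ereal_sup (range (fun N => (dot (c N) p)%:E)) =
    ereal_sup (range (fun N => (max_dot p N)%:E)).
  apply/eqP; rewrite eq_le; apply/andP; split; apply: ge_ereal_sup => _ [N _ <-].
    apply: (@le_trans _ _ (max_dot p N)%:E); first by rewrite lee_fin dot_le_max.
    by apply: ereal_sup_ubound; exists N.
  by apply: ereal_sup_ubound; exists (argmax_dot p N).
by apply: ereal_nondecreasing_cvgn => i j ij; rewrite lee_fin nondecreasing_max_dot.
Qed.

Context {d : measure_display} {T : measurableType d}.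
Variable q : T -> 'rV[R]_m.
Hypothesis mq : forall i, measurable_fun setT (fun x => q x 0 i).

Lemma measurable_dot (v : T -> 'rV[R]_m) :
  (forall i, measurable_fun setT (fun x => v x 0 i)) ->
  measurable_fun setT (fun x => dot (v x) (q x)).
Proof.
by move=> mv; apply: measurable_sum => i; exact: measurable_funM.
Qed.

Lemma measurable_argmax N : measurable_fun setT (fun x => argmax_dot (q x) N).
Proof.
elim: N => [|N IH]; first exact: measurable_cst.
apply: measurable_fun_ifT => //; first last.
apply: measurable_fun_ltr; apply: measurable_dot => i //.
by apply: (measurableT_comp (f := fun M => c M 0 i)).
Qed.

Lemma measurable_max_dot N : measurable_fun setT (fun x => max_dot (q x) N).
Proof.
apply: measurable_dot => i.
by apply: (measurableT_comp (f := fun M => c M 0 i)) => //; exact: measurable_argmax.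
Qed.

Lemma measurable_sup_dot :
  measurable_fun setT (fun x => ereal_sup (range (fun N => (dot (c N) (q x))%:E))).
Proof.
apply: (emeasurable_fun_cvg (fun N x => (max_dot (q x) N)%:E)).
  by move=> N; apply/measurable_EFinP; exact: measurable_max_dot.
by move=> x _; exact: cvg_max_dot.
Qed.

End running_argmax.

(** * Lower semicontinuity of the losses and extended-real arithmetic *)

Lemma continuous_open_gt (R : realType) m (h : 'rV[R]_m -> R) r :
  continuous h -> open [set a | (r < h a)%R].
Proof.
move=> hc; apply: (@open_comp _ _ h [set y | (r < y)%R]) => [x _|].
  exact: hc.
exact: open_gt.
Qed.

(** The conjugate is a supremum of continuous affine functions; at points of
    the simplex where the support function is infinite there is nothing to
    take into account. *)
Lemma open_conjugate_gt (R : realType) n (f : 'rV[R]_n -> \bar R)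
    (f_convex : convex_ereal f) (f_closed : closed_function f)
    (f1 : f (const_mx 1%R) = 0) r : open [set a | (r < conjugate f a)%R].
Proof.
rewrite openE => a /= ra.
have : r%:E < (conjugate f a)%:E by rewrite lte_fin.
rewrite -conjugate_fin// => /ereal_sup_gt[_ [p sp <-]].
have pinfty : minorant_support f p = +oo ->
    ~ r%:E < (dot p a)%:E - n.+1%:R%:E * minorant_support f p.
  by move=> ->; rewrite mulry gtr0_sg// mul1e addeNy.
have := minorant_support_gtNy f_convex f_closed (dom_ones f1) p.
case E : (minorant_support f p) pinfty => [s||] // => [_ _|H _ /H]; last by case.
rewrite -EFinM -EFinB lte_fin ltrBrDr => rs.
have : open [set b | r + n.+1%:R * s < dot p b]%R.
  by apply: continuous_open_gt; exact: continuous_dot.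
rewrite openE => /(_ a rs); apply: filterS => b /= rb.
rewrite -lte_fin -(conjugate_fin f_convex f_closed f1).
apply: lt_le_trans (_ : (dot p b)%:E - n.+1%:R%:E * minorant_support f p <= _).
  by rewrite E -EFinM -EFinB lte_fin ltrBrDr.
by apply: ereal_sup_ubound; exists p.
Qed.

Lemma measurable_open_gt d (T : measurableType d) (R : realType) m
    (h : 'rV[R]_m.+1 -> R) (gamma : T -> 'rV[R]_m.+1) :
  borel_measurable gamma -> (forall r, open [set a | (r < h a)%R]) ->
  measurable_fun setT (h \o gamma).
Proof.
move=> mg oh; apply: (measurability _ (RGenOInfty.measurableE R)).
move=> /= _ [_ [a ->]] <-.
have -> : (h \o gamma) @^-1` `]a, +oo[%classic = gamma @^-1` [set b | (a < h b)%R].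
  by apply/seteqP; split => x /=; rewrite in_itv/= andbT.
by apply: mg => //; apply: sub_gen_smallest; exact: oh.
Qed.

(** The bookkeeping of infinities in [expectation_ge]: [A i] and [B i] are the
    integrals of the negative and positive parts of the [i]-th loss, [Fm] and
    [Fp] those of the integrand of the divergence.  Under either alternative of
    the hypothesis, if [Fp] is finite then all the [A i] are finite, so that
    no difference below is [+oo - oo]. *)
Lemma oppe_div_le_esum (R : realType) m (w : R) (A B : 'I_m -> \bar R) (Fp Fm : \bar R) :
  (0 < w)%R -> (forall i, 0 <= A i) -> (forall i, 0 <= B i) ->
  0 <= Fp -> 0 <= Fm -> Fm < +oo ->
  (\sum_i w%:E * B i < +oo) \/ (\sum_i w%:E * A i < +oo) ->
  \sum_i A i + w^-1%:E * Fm <= \sum_i B i + w^-1%:E * Fp ->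
  - (Fp - Fm) <= \sum_i w%:E * (B i - A i).
Proof.
move=> w0 A0 B0 Fp0 Fm0; case: Fm Fm0 => [fm||]// fm0 _.
case: Fp Fp0 => [fp||]// fp0; last by rewrite leNye.
move=> BA AB.
have sumZ F : (forall i, 0 <= F i) -> \sum_i w%:E * F i = w%:E * \sum_(i < m) F i.
  by move=> F0; rewrite ge0_sume_distrr.
have fin_sum F : (forall i, 0 <= F i) -> w%:E * \sum_(i < m) F i < +oo ->
    \sum_(i < m) F i < +oo.
  move=> F0; rewrite !ltey; apply: contra_neq => ->.
  by rewrite mulry gtr0_sg// mul1e.
have sA : \sum_i A i < +oo.
  case: BA; rewrite sumZ// => /fin_sum H; last exact: H.
  apply: le_lt_trans (_ : \sum_i A i + w^-1%:E * fm%:E < +oo).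
    by rewrite leeDl// -EFinM lee_fin mulr_ge0// invr_ge0 ltW.
  by apply: le_lt_trans AB _; rewrite lte_add_pinfty// ?H// -EFinM ltry.
have AE i : A i = (fine (A i))%:E.
  rewrite fineK// ge0_fin_numE//; apply: le_lt_trans sA.
  by rewrite (bigD1 i)//= leeDl// sume_ge0.
have [[i Bi]|Bfin] := pselect (exists i, B i = +oo).
  rewrite (_ : \sum_i _ = +oo) ?leey//; apply/esum_eqyP => [j _|].
    by rewrite AE; case: (B j) (B0 j) => [b||]//= _; rewrite mulry gtr0_sg// mul1e.
  by exists i; rewrite mem_index_enum Bi AE/= mulry gtr0_sg// mul1e.
have BE i : B i = (fine (B i))%:E.
  rewrite fineK// ge0_fin_numE// ltey; apply/eqP => Bi; apply: Bfin.
  by exists i.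
move: AB; under eq_bigr do rewrite AE; under [in X in _ <= X]eq_bigr do rewrite BE.
under [in X in _ -> _ <= X]eq_bigr do rewrite AE BE -EFinB -EFinM.
rewrite !sumEFin -!EFinM -!EFinD !lee_fin -mulr_sumr sumrB => H.
have := ler_wpM2l (ltW w0) H; rewrite !mulrDr !mulrA mulfV ?gt_eqF// !mul1r; lra.
Qed.

(** * Divergence and Bayes risk *)

Section divergence.
Local Open Scope charge_scope.
Variables (R : realType) (n : nat) (f : 'rV[R]_n -> \bar R).
Hypotheses (f_convex : convex_ereal f) (f_closed : closed_function f).
Hypothesis f1 : f (const_mx 1%R) = 0.
Context {d : measure_display} {T : measurableType d}.
Variables (P : 'I_n.+1 -> probability T R)
  (mu : {sigma_finite_measure set T -> \bar R}).
Hypothesis Pmu : forall i, P i `<< mu.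

Let df := dom_ones f1.
Local Notation k := (n.+1%:R : R)%R.
Local Notation phi := (minorant_support f).

(** This version of the Radon-Nikodym derivative is nonnegative everywhere and
    not only almost everywhere, so that Fenchel-Young applies at every point. *)
Definition rn i : T -> \bar R := Radon_Nikodym_SigmaFinite.f (P i) mu.
Definition densities (x : T) : 'rV[R]_n.+1 := \row_i fine (rn i x).
Local Notation q := densities.

Lemma densitiesE i x : (q x 0%R i)%:E = rn i x.
Proof. by rewrite mxE fineK//; exact: (Radon_Nikodym_SigmaFinite.f_fin_num (Pmu i)). Qed.

Lemma densities_ge0 i x : (0 <= q x 0 i)%R.
Proof. by rewrite mxE fine_ge0//; exact: (Radon_Nikodym_SigmaFinite.f_ge0 (Pmu i)). Qed.

Lemma integrable_densities i : mu.-integrable setT (fun x => (q x 0%R i)%:E).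
Proof.
under eq_fun do rewrite densitiesE.
exact: (Radon_Nikodym_SigmaFinite.f_integrable (Pmu i)).
Qed.

Lemma measurable_densities i : measurable_fun setT (fun x => q x 0%R i).
Proof. by apply/measurable_EFinP; apply: (measurable_int mu); exact: integrable_densities. Qed.

Lemma ge0_integral_densities i (g : T -> \bar R) : (forall x, 0 <= g x) ->
  measurable_fun setT g ->
  \int[mu]_x (g x * (q x 0%R i)%:E) = \int[P i]_x g x.
Proof.
move=> g0 mg; under eq_integral do rewrite densitiesE.
exact: (Radon_Nikodym_SigmaFinite.change_of_variables (Pmu i)).
Qed.

Lemma ae_densities i :
  {ae mu, forall x, fine ('d (charge_of_finite_measure (P i)) '/d mu x) = q x 0%R i}.
Proof.
have := ae_eq_Radon_Nikodym_SigmaFinite (Pmu i) measurableT.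
by apply: filterS => x /(_ I) <-; rewrite mxE.
Qed.

Lemma integral_densities i (h : T -> R) : (P i).-integrable setT (EFin \o h) ->
  \int[mu]_x ((h x)%:E * (q x 0%R i)%:E) = \int[P i]_x (h x)%:E.
Proof.
move=> ih; rewrite -(Radon_Nikodym_change_of_variables (Pmu i) measurableT ih).
have mh : measurable_fun setT (EFin \o h) := measurable_int _ ih.
apply: ae_eq_integral => //.
- by apply: emeasurable_funM => //; apply/measurable_EFinP; exact: measurable_densities.
- apply: emeasurable_funM => //; apply: measurable_int.
  by apply: Radon_Nikodym_integrable; exact: Pmu.
- have := ae_densities i; apply: filterS => x /= <- _.
  by rewrite fineK//; apply: Radon_Nikodym_fin_num; exact: Pmu.
Qed.

Lemma measurable_phi (p : T -> 'rV[R]_n.+1) :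
  (forall i, measurable_fun setT (fun x => p x 0%R i)) ->
  measurable_fun setT (fun x => phi (p x)).
Proof.
move=> mp; have [c _ cE] := countable_minorants f_convex f_closed df.
under eq_fun do rewrite cE.
exact: measurable_sup_dot.
Qed.

(** The densities of the definition agree almost everywhere with the
    nonnegative ones.  On the exceptional set the integrand remains a
    measurable function, since [closed_perspectiveE] also covers negative
    [u]. *)
Lemma f_divergenceE : f_divergence f P mu = \int[mu]_x phi (q x).
Proof.
pose rn' i x : R := fine ('d (charge_of_finite_measure (P i)) '/d mu x).
have mrn i : measurable_fun setT (rn' i).
  apply: measurableT_comp => //.
  by apply: measurable_int; apply: Radon_Nikodym_integrable; exact: Pmu.
rewrite /f_divergence; under eq_integral do rewrite closed_perspectiveE//.
apply: ae_eq_integral => //.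
- apply: measurable_phi => i; under eq_fun do rewrite mxE.
  case: unlift => [j|]/=.
    by under eq_fun do rewrite mxE; exact: mrn.
  by apply: measurable_maxr => //; exact: mrn.
- by apply: measurable_phi => i; exact: measurable_densities.
- have : {ae mu, forall x, forall i, rn' i x = q x 0%R i}.
    by apply: filter_forall => i; exact: ae_densities.
  apply: filterS => x qx _; congr phi.
  rewrite -[RHS]snoc_body; congr snoc; last by rewrite -/(rn' _ x) qx max_l// densities_ge0.
  by apply/rowP => i; rewrite !mxE -/(rn' _ x) qx mxE.
Qed.

Lemma phi_ge c x : minorants f c -> (dot c (q x))%:E <= phi (q x).
Proof. exact: minorant_support_ge. Qed.

Lemma integrable_dot_densities (h : T -> 'rV[R]_n.+1) :
  (forall i, (P i).-integrable setT (fun x => (h x 0%R i)%:E)) ->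
  (forall i, measurable_fun setT (fun x => h x 0%R i)) ->
  (forall i, [bounded h x 0%R i | x in setT]) ->
  mu.-integrable setT (fun x => (dot (h x) (q x))%:E) /\
  \int[mu]_x (dot (h x) (q x))%:E = \sum_i \int[P i]_x (h x 0%R i)%:E.
Proof.
move=> ih mh bh.
have ihq i : mu.-integrable setT (fun x => (h x 0%R i)%:E * (q x 0%R i)%:E).
  by apply: (integrableMr measurableT (mh i) (bh i)); exact: integrable_densities.
have E : (fun x => (dot (h x) (q x))%:E) =
    (fun x => \sum_i (h x 0%R i)%:E * (q x 0%R i)%:E).
  by apply/funext => x; rewrite /dot -sumEFin; apply: eq_bigr => i _; rewrite EFinM.
rewrite E; split; first exact: integrable_sum.
rewrite integral_sum//; apply: eq_bigr => i _; exact: integral_densities.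
Qed.

Local Notation p0 := (uniform_prior R n).
Local Notation L := (loss f).

(** Any minorant bounds [phi (q x)] from below by an integrable function. *)
Lemma phi_integrable_neg : \int[mu]_x (fun x => phi (q x))^\- x < +oo.
Proof.
have [c Mc] := minorants_neq0 f_convex f_closed df.
have [ic _] : mu.-integrable setT (fun x => (dot c (q x))%:E) /\
    \int[mu]_x (dot c (q x))%:E = \sum_i \int[P i]_x (c 0%R i)%:E.
  apply: (@integrable_dot_densities (fun=> c)) => i.
  - exact: finite_measure_integrable_cst.
  - exact: measurable_cst.
  - exact: bounded_cst.
have mphi := measurable_phi measurable_densities.
apply: le_lt_trans (_ : \int[mu]_x (fun x => (dot c (q x))%:E)^\- x < +oo).
  apply: ge0_le_integral => //.
  - exact: measurable_funeneg.
  - by apply: measurable_funeneg; exact: measurable_int ic.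
  - by move=> x _; apply: (@funeneg_le _ _ setT) => [y _|]; rewrite ?inE//; exact: phi_ge.
by rewrite ltey_eq (integrable_neg_fin_num measurableT ic).
Qed.

(** Fenchel-Young at [p = q x] and [a = gamma x], integrated.  The inequality
    is first rearranged between positive and negative parts, so that only
    nonnegative functions are integrated. *)
Lemma expectation_ge (gamma : T -> 'rV[R]_n.+1) :
  borel_measurable gamma ->
  expectation_exists p0 P (fun x y => L (gamma x) y) ->
  - (\int[mu]_x phi (q x)) <= expectation_XY p0 P (fun x y => L (gamma x) y).
Proof.
move=> mg.
pose g i x : \bar R := L (gamma x) i.
have mG i : measurable_fun setT (g i).
  rewrite /g; under eq_fun do rewrite lossE//.
  apply/measurable_EFinP; apply: measurable_funB.
    apply: (measurable_open_gt mg) => r; exact: open_conjugate_gt.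
  apply: (measurable_open_gt (h := fun a => a 0%R i) mg) => r.
  by apply: continuous_open_gt; exact: coord_continuous.
have mphi := measurable_phi measurable_densities.
rewrite /expectation_exists /expectation_XY -/g => ex.
rewrite [X in - X](integralE _ _ (fun x => phi (q x))).
under [X in _ <= X]eq_bigr do rewrite integralE mxE.
apply: (@oppe_div_le_esum _ _ k^-1) => //.
- by move=> i; apply: integral_ge0 => x _; exact: funeneg_ge0.
- by move=> i; apply: integral_ge0 => x _; exact: funepos_ge0.
- by apply: integral_ge0 => x _; exact: funepos_ge0.
- by apply: integral_ge0 => x _; exact: funeneg_ge0.
- exact: phi_integrable_neg.
- case: ex => ex; [left|right]; apply: le_lt_trans ex; apply: lee_sum => i _;
    rewrite mxE lee_wpmul2l ?lee_fin ?invr_ge0//.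
    by rewrite (eq_integral (fun x => maxe (g i x) 0))// => x _; rewrite funeposE.
  by rewrite (eq_integral (fun x => maxe (- g i x) 0))// => x _; rewrite funenegE.
rewrite invrK.
have sumE (h : 'I_n.+1 -> T -> \bar R) (u : T -> \bar R) :
    (forall i, measurable_fun setT (h i)) -> (forall i x, 0 <= h i x) ->
    measurable_fun setT u -> (forall x, 0 <= u x) ->
  \sum_i \int[P i]_x h i x + k%:E * \int[mu]_x u x =
  \int[mu]_x (\sum_i h i x * (q x 0%R i)%:E + k%:E * u x).
  move=> mh h0 mu_ u0.
  have mhq i : measurable_fun setT (fun x => h i x * (q x 0%R i)%:E).
    by apply: emeasurable_funM => //; apply/measurable_EFinP; exact: measurable_densities.
  have hq0 i x : 0 <= h i x * (q x 0%R i)%:E.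
    by rewrite mule_ge0// lee_fin densities_ge0.
  rewrite ge0_integralD//; first last.
  - exact: emeasurable_funM.
  - by move=> x _; rewrite mule_ge0.
  - exact: emeasurable_sum.
  - by move=> x _; exact: sume_ge0.
  rewrite ge0_integral_sum// ge0_integralZl//.
  by congr (_ + _); apply: eq_bigr => i _; rewrite ge0_integral_densities.
rewrite sumE//; [|by move=> i; exact: measurable_funeneg (mG i)|exact: measurable_funeneg].
rewrite sumE//; [|by move=> i; exact: measurable_funepos (mG i)|exact: measurable_funepos].
have mhq i h : measurable_fun setT h ->
    measurable_fun setT (fun x => h x * (q x 0%R i)%:E).
  move=> mh; apply: emeasurable_funM => //.
  by apply/measurable_EFinP; exact: measurable_densities.
apply: ge0_le_integral => //.
- move=> x _; apply: adde_ge0; last by rewrite mule_ge0// ?lee_fin// funeneg_ge0.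
  by apply: sume_ge0 => i _; rewrite mule_ge0 ?funeneg_ge0// lee_fin densities_ge0.
- apply: emeasurable_funD.
    by apply: emeasurable_sum => i; apply: mhq; exact: measurable_funeneg (mG i).
  by apply: emeasurable_funM => //; exact: measurable_funeneg.
- apply: emeasurable_funD.
    by apply: emeasurable_sum => i; apply: mhq; exact: measurable_funepos (mG i).
  by apply: emeasurable_funM => //; exact: measurable_funepos.
- move=> x _; rewrite funenegE funeposE.
  have maxE (r : R) : maxe r%:E 0 = (Num.max r 0)%:E by rewrite EFin_max.
  under eq_bigr do rewrite funenegE lossE// -EFinN maxE -EFinM.
  under [in X in _ <= X]eq_bigr do rewrite funeposE lossE// maxE -EFinM.
  rewrite !sumEFin.
  have := fenchel_young f_convex f_closed f1 (gamma x) (densities_ge0 ^~ x).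
  have := minorant_support_gtNy f_convex f_closed df (q x).
  case: (phi (q x)) => [s _||] //; last first.
    by move=> _ _; rewrite maxye mulry gtr0_sg// mul1e addey ?leey.
  rewrite -EFinN !maxE -!EFinM -!EFinD !lee_fin => FY.
  have maxN (r : R) : (Num.max r 0 = Num.max (- r) 0 + r)%R.
    by rewrite !maxEle; case: (leP r) => ?; case: leP => ?; lra.
  rewrite -subr_ge0.
  have -> : (\sum_i Num.max (conjugate f (gamma x) - gamma x 0 i) 0 * q x 0 i =
     \sum_i Num.max (- (conjugate f (gamma x) - gamma x 0 i)) 0 * q x 0 i
     - (dot (q x) (gamma x) - (\sum_i q x 0 i) * conjugate f (gamma x)))%R.
    rewrite mulr_suml -!sumrB; apply: eq_bigr => i _.
    by rewrite maxN; ring.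
  by rewrite (maxN s); lra.
Qed.

Section plug_in.
Variable c : nat -> 'rV[R]_n.+1.
Hypothesis Mc : forall m, minorants f (c m).
Variable N : nat.

Let index x := argmax_dot c (q x) N.
(** The score vector attached to the best of the first minorants at [q x]. *)
Definition plug_in x : 'rV[R]_n.+1 := (k *: c (index x))%R.

Let measurable_index : measurable_fun setT index.
Proof. exact: measurable_argmax measurable_densities N. Qed.

Let bounded_index (h : nat -> R) : [bounded h (index x) | x in setT].
Proof.
exists (\sum_(m < N.+1) `|h m|)%R; split; first exact: num_real.
move=> M /ltW hM x _ /=; apply: le_trans hM.
have iN : (index x < N.+1)%N by rewrite ltnS argmax_dot_le.
by rewrite (bigD1 (Ordinal iN))//= lerDl sumr_ge0.
Qed.

Let measurable_of_index (h : nat -> R) : measurable_fun setT (fun x => h (index x)).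
Proof. by apply: (measurableT_comp (f := h)). Qed.

Let integrable_index i (h : nat -> R) :
  (P i).-integrable setT (fun x => (h (index x))%:E).
Proof.
apply: measurable_bounded_integrable => //.
by rewrite (le_lt_trans (probability_le1 _ _))// ltry.
Qed.

(** The predictor factors through the measurable index, which ranges over
    a countable type, so that the preimage of any set at all is measurable. *)
Lemma borel_plug_in : borel_measurable plug_in.
Proof.
move=> _ Y _; rewrite setTI.
have -> : plug_in @^-1` Y = index @^-1` [set m | Y (k *: c m)%R] by [].
by rewrite -[_ @^-1` _]setTI; exact: measurable_index.
Qed.

Lemma integral_max_dot :
  mu.-integrable setT (fun x => (max_dot c (q x) N)%:E) /\
  \int[mu]_x (max_dot c (q x) N)%:E = \sum_i \int[P i]_x (c (index x) 0%R i)%:E.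
Proof.
apply: (integrable_dot_densities (h := fun x => c (index x))) => i.
- exact: (integrable_index i (fun m => c m 0%R i)).
- exact: (measurable_of_index (fun m => c m 0%R i)).
- exact: (bounded_index (fun m => c m 0%R i)).
Qed.

(** By [conjugate_minorant] the [i]-th loss of the predictor is at most
    [- k c_i]; the uniform prior cancels the factor [k]. *)
Lemma plug_in_risk : \int[mu]_x (max_dot c (q x) N)%:E <= - bayes_risk p0 P L.
Proof.
have LE x i : L (plug_in x) i =
    ((fun m => conjugate f (k *: c m) - (k *: c m) 0%R i)%R (index x))%:E.
  by rewrite lossE.
have intL i : (P i).-integrable setT (fun x => L (plug_in x) i).
  under eq_fun do rewrite LE.
  exact: (integrable_index i (fun m => conjugate f (k *: c m) - (k *: c m) 0%R i)%R).
have p0_lty (F : 'I_n.+1 -> \bar R) : (forall i, F i \is a fin_num) ->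
    \sum_y (p0 0%R y)%:E * F y < +oo.
  move=> Ffin; rewrite ltey_eq; apply/orP; left; apply/sum_fin_numP => i _ _.
  by rewrite fin_numM.
rewrite integral_max_dot.2 leeNr.
apply: (@le_trans _ _ (expectation_XY p0 P (fun x y => L (plug_in x) y))).
  apply: ereal_inf_lbound; exists plug_in => //; split; first exact: borel_plug_in.
  left; apply: p0_lty => i.
  rewrite (eq_integral (fun x => L (plug_in x) i)^\+) => [|x _]; last by rewrite funeposE.
  exact: integrable_pos_fin_num (intL i).
rewrite -sumeN; last first.
  move=> i j _ _; rewrite fin_num_adde_defl//.
  exact: (integrable_fin_num measurableT (integrable_index j (fun m => c m 0%R j))).
apply: lee_sum => i _.
have iL : \int[P i]_x L (plug_in x) i <= \int[P i]_x (- k * c (index x) 0%R i)%:E.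
  apply: le_integral => //; first exact: intL.
    exact: (integrable_index i (fun m => - k * c m 0%R i)%R).
  move=> x _; rewrite LE lee_fin mulNr mxE lerBlDr addNr.
  exact: conjugate_minorant.
rewrite mxE; apply: le_trans (lee_wpmul2l _ iL) _; first by rewrite lee_fin invr_ge0.
under eq_integral do rewrite EFinM.
rewrite integralZl//; last exact: (integrable_index i (fun m => c m 0%R i)).
by rewrite muleA -EFinM mulrN mulVf// EFinN mulN1e.
Qed.

End plug_in.

(** Monotone convergence applies to the nonnegative differences
    [max_dot c (q x) N - dot (c 0) (q x)].  The integral of the subtracted
    term is finite, and adding it back is legitimate as soon as the limit is
    integrable, which holds unless the bound is infinite. *)
Lemma integral_phi_le : \int[mu]_x phi (q x) <= - bayes_risk p0 P L.
Proof.
have [c Mc cE] := countable_minorants f_convex f_closed df.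
pose v N x := max_dot c (q x) N.
have mphi := measurable_phi measurable_densities.
have mv N : measurable_fun setT (v N) := measurable_max_dot c measurable_densities N.
have iv N : mu.-integrable setT (EFin \o v N) := (integral_max_dot c N).1.
have v0fin : \int[mu]_x (v 0%N x)%:E \is a fin_num.
  exact: integrable_fin_num measurableT _ (iv 0%N).
pose r := - bayes_risk p0 P L.
have excess : \int[mu]_x (phi (q x) - (v 0%N x)%:E) <= r - \int[mu]_x (v 0%N x)%:E.
  have limE x : phi (q x) - (v 0%N x)%:E = limn (fun N => (v N x - v 0%N x)%:E).
    apply/esym/cvg_lim => //; under eq_fun do rewrite EFinB.
    apply: cvgeB; [|rewrite cE; exact: cvg_max_dot|exact: cvg_cst].
    by rewrite fin_num_adde_defl.
  under eq_integral do rewrite limE.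
  have -> := @monotone_convergence _ _ _ mu _ measurableT (fun N x => (v N x - v 0%N x)%:E).
  - apply: lime_le; last first.
      apply: nearW => N; rewrite integralB_EFin//; apply: leeB => //.
      exact: plug_in_risk.
    apply: ereal_nondecreasing_is_cvgn => i j ij; apply: ge0_le_integral => //.
    + by move=> x _; rewrite lee_fin subr_ge0 nondecreasing_max_dot.
    + by apply/measurable_EFinP; exact: measurable_funB.
    + by apply/measurable_EFinP; exact: measurable_funB.
    + by move=> x _; rewrite lee_fin lerD2r nondecreasing_max_dot.
  - by move=> N; apply/measurable_EFinP; exact: measurable_funB.
  - by move=> N x _; rewrite lee_fin subr_ge0 nondecreasing_max_dot.
  - by move=> x _ i j ij; rewrite lee_fin lerD2r nondecreasing_max_dot.
have phi_v0 x : 0 <= phi (q x) - (v 0%N x)%:E.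
  rewrite sube_ge0//; exact: minorant_support_ge.
rewrite -/r; have [->|rfin] := eqVneq r +oo; first by rewrite leey.
have mexc : measurable_fun setT (fun x => phi (q x) - (v 0%N x)%:E).
  by apply: emeasurable_funB => //; exact/measurable_EFinP.
have iexc : mu.-integrable setT (fun x => phi (q x) - (v 0%N x)%:E).
  apply/integrableP; split => //.
  under eq_integral do rewrite gee0_abs//.
  apply: le_lt_trans excess _; apply: lte_add_pinfty; first by rewrite ltey.
  by rewrite -(fineK v0fin) -EFinN ltry.
have -> : \int[mu]_x phi (q x) =
    \int[mu]_x (phi (q x) - (v 0%N x)%:E) + \int[mu]_x (v 0%N x)%:E.
  rewrite -integralD//; last exact: iv.
  by apply: eq_integral => x _; rewrite subeK.
apply: le_trans (leeD2r _ excess) _.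
by rewrite subeK.
Qed.

Lemma f_divergence_bayes_risk : f_divergence f P mu = - bayes_risk p0 P L.
Proof.
rewrite f_divergenceE; apply/eqP; rewrite eq_le integral_phi_le/= leeNl.
apply: le_ereal_inf_tmp => _ [gamma [mg ex] <-]; exact: expectation_ge.
Qed.

End divergence.

Theorem corollary3 (R : realType) (n : nat) (f : 'rV[R]_n -> \bar R)
    (f_convex : convex_ereal f) (f_closed : closed_function f)
    (f1 : f (const_mx 1%R) = 0) :
  let p0 := uniform_prior R n in
  let L := loss f in
  [/\ forall i : 'I_n.+1, convex_ereal (fun a => L a i),
      forall t : 'rV[R]_n, (forall i, 0 <= t 0 i)%R ->
        f t = ereal_sup
          [set entropy L p0
               - \sum_(i < n) (p0 0 (inner i))%:E * L a (inner i) * (t 0 i)%:E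
               - (p0 0 ord_max)%:E * L a ord_max
          | a in [set: 'rV[R]_n.+1]]
    & forall (d : measure_display) (T : measurableType d)
        (P : 'I_n.+1 -> probability T R)
        (mu : {sigma_finite_measure set T -> \bar R}),
        (forall i, P i `<< mu) ->
        f_divergence f P mu =
          ereal_inf [set \sum_i (p0 0 i)%:E * L a i
                    | a in [set: 'rV[R]_n.+1]]
          - bayes_risk p0 P L].
Proof.
move=> p0 L; split=> [i|t t0|d T P mu Pmu].
- exact: loss_convex.
- by rewrite [entropy L p0]entropy_uniform//; exact: biconjugate.
- rewrite (_ : ereal_inf _ = 0); last exact: entropy_uniform.
  by rewrite sub0e; exact: f_divergence_bayes_risk.
Qed.
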